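(* Let $K$ be a metric space and $f\in SD(K)$. Then $(\operatorname{osc}_nf)_{n=1}^\infty$ converges uniformly to $\operatorname{osc}_\omega f$ on $K$.
   Context: $D(K)$ is the set of all $f:K\to\mathbb{C}$ of the form $f=(\varphi_1-\varphi_2)+i(\varphi_3-\varphi_4)$ with $\varphi_1,\dots,\varphi_4$ bounded real-valued lower semi-continuous functions on $K$. Equivalently, $f\in D(K)$ iff there is a sequence $(\varphi_j)$ of continuous complex-valued functions on $K$ with $\sup_{k\in K}\sum_j|\varphi_j(k)|<\infty$ and $f=\sum_j\varphi_j$ pointwise; $\|f\|_D$ is the infimum of $\sup_{k\in K}\sum_j|\varphi_j(k)|$ over all such sequences. A function is simple if its range is finite. $SD(K)$ is the closure, in $(D(K),\|\cdot\|_D)$, of the set of simple functions belonging to $D(K)$. All $\limsup$'s are non-exclusive (the point itself is allowed). For $\varphi:K\to[-\infty,\infty]$, $U\varphi(x)=\limsup_{y\to x}\varphi(y)$. Transfinite oscillations: $\operatorname{osc}_0f\equiv0$. For an ordinal $\beta=\alpha+1$, $\widetilde{\operatorname{osc}}_\beta f(x)=\limsup_{y\to x}\bigl(|f(y)-f(x)|+\operatorname{osc}_\alpha f(y)\bigr)$; for a limit ordinal $\beta$, $\widetilde{\operatorname{osc}}_\beta f=\sup_{\alpha<\beta}\operatorname{osc}_\alpha f$; in both cases $\operatorname{osc}_\beta f=U\,\widetilde{\operatorname{osc}}_\beta f$. $\omega$ is the first infinite ordinal. *)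

(* Defs.v *)
From HB Require Import structures.
From mathcomp Require Import all_boot all_order all_algebra.
From mathcomp Require Import complex.
From mathcomp Require Import all_classical all_reals all_analysis.

Set Implicit Arguments.
Unset Strict Implicit.
Unset Printing Implicit Defensive.

Import Order.TTheory GRing.Theory Num.Theory.
Import numFieldNormedType.Exports.

Local Open Scope classical_set_scope.
Local Open Scope ring_scope.

(* The regular algebra [(R[i])^o] carries the topology of the modulus, while
   [R[i]] itself is not declared as a topological space. *)
Notation cplx R := ((complex R)^o) (only parsing).

(* The library norm [`|z|] of [z : R[i]] lives in [R[i]]; this one is real. *)
Definition cmod (R : realType) (z : cplx R) : R := @Normc.normc R z.

Section ClassD.
Context {R : realType} {K : metricType R}.
Implicit Types f g : K -> cplx R.

Definition bounded_lsc (phi : K -> R) : Prop :=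
  bounded_fun (phi : K -> R^o) /\ lower_semicontinuous (EFin \o phi).

Definition classD f : Prop :=
  exists phi1 phi2 phi3 phi4 : K -> R,
    [/\ bounded_lsc phi1, bounded_lsc phi2, bounded_lsc phi3,
        bounded_lsc phi4 &
        forall x, f x = Complex (phi1 x - phi2 x) (phi3 x - phi4 x)].

Definition sup_abs_sum (phi : nat -> K -> cplx R) : \bar R :=
  ereal_sup (range (fun k : K => (\sum_(0 <= j <oo) (cmod (phi j k))%:E)%E)).

Definition D_repr f (phi : nat -> K -> cplx R) : Prop :=
  [/\ forall j, continuous (phi j),
      (sup_abs_sum phi < +oo)%E &
      forall k, series (fun j => phi j k) @ \oo --> f k].

Definition D_norm f : \bar R :=
  ereal_inf [set sup_abs_sum phi | phi in D_repr f].

Definition simple f : Prop := finite_set (range f).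

Definition classSD f : Prop :=
  classD f /\
  forall e : R, 0 < e ->
    exists g, [/\ classD g, simple g & (D_norm (f \- g)%R < e%:E)%E].

End ClassD.

Section Oscillation.
Context {R : realType} {K : metricType R}.
Local Open Scope ereal_scope.

(* [nbhs x] is not punctured, so this is the non-exclusive limsup. *)
Definition usc_env (phi : K -> \bar R) (x : K) : \bar R :=
  limf_esup phi (nbhs x).

Definition osc_tilde_succ (f : K -> cplx R) (osca : K -> \bar R) (x : K)
  : \bar R :=
  usc_env (fun y => (cmod (f y - f x)%R)%:E + osca y) x.

Fixpoint osc (n : nat) (f : K -> cplx R) : K -> \bar R :=
  if n is m.+1 then usc_env (osc_tilde_succ f (osc m f)) else cst 0.

Definition osc_tilde_omega (f : K -> cplx R) (x : K) : \bar R :=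
  ereal_sup (range (fun n => osc n f x)).

Definition osc_omega (f : K -> cplx R) : K -> \bar R :=
  usc_env (osc_tilde_omega f).

End Oscillation.

(* Since [`|u - v|] is [+oo] as soon as [u] or [v] is infinite, this also says
   that the limit and eventually all [F n] are finite everywhere. The library's
   uniform structure on [\bar R] is not used: it compresses distances near
   infinity. *)
Definition ereal_uniform_cvg (R : realType) (T : Type)
    (F : nat -> T -> \bar R) (G : T -> \bar R) : Prop :=
  forall e : R, 0 < e ->
    \forall n \near \oo, forall x, (`|F n x - G x| < e%:E)%E.

(* Main.v *)
(* Write [h = sum_j phi_j] and [F = sum_j |phi_j| <= M]. Near every [x],
   [|h y - h x| <= F y - F x + e], and by induction
   [osc_n (g + h) <= osc_n g + (M - F)]; so all [osc_n] are perturbed by at most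
   [||h||_D]. It remains to see that for a simple [g] in [D(K)] the sequence
   [osc_n g] is eventually constant. Let [K_0 = K] and let [K_(i+1)] be the set
   of points of [K_i] where [g|K_i] is not locally constant. If [d] is the
   smallest distance between two values of [g], then [osc_i g >= i d] on [K_i],
   so [K_N] is empty for some [N] as the [osc_i g] are uniformly bounded, and
   off [K_i] the sequence [osc_n g] is constant from rank [i] on. *)

Require Import Defs.
From mathcomp Require Import all_boot all_order all_algebra.
From mathcomp Require Import complex.
From mathcomp Require Import all_classical all_reals all_analysis.
From mathcomp Require Import lra.

Set Implicit Arguments.
Unset Strict Implicit.
Unset Printing Implicit Defensive.

Import Order.TTheory GRing.Theory Num.Theory.
Import numFieldNormedType.Exports.

Local Open Scope classical_set_scope.
Local Open Scope ring_scope.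

(** * Upper semicontinuous envelopes *)

Section Envelope.
Context {R : realType} {K : metricType R}.
Implicit Types (phi psi : K -> \bar R) (x y : K) (a c : \bar R).
Local Open Scope ereal_scope.

Lemma usc_env_le_sup phi x (V : set K) : nbhs x V ->
  usc_env phi x <= ereal_sup (phi @` V).
Proof. by move=> Vx; apply: ereal_inf_lbound; exists V. Qed.

Lemma usc_env_near_le phi x c : (\forall y \near x, phi y <= c) ->
  usc_env phi x <= c.
Proof.
move=> Vx; apply: le_trans (usc_env_le_sup _ Vx) _.
by apply: ge_ereal_sup => _ [y Vy <-].
Qed.

Lemma usc_env_lt_near phi x c : usc_env phi x < c ->
  \forall y \near x, phi y < c.
Proof.
move=> /ereal_inf_lt[_ [V Vx <-] ltc].
apply: filterS Vx => y Vy; apply: le_lt_trans ltc.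
by apply: ereal_sup_ubound; exists y.
Qed.

Lemma usc_env_ge_frequently phi x c :
  (forall V : set K, nbhs x V -> exists2 y, V y & c <= phi y) ->
  c <= usc_env phi x.
Proof.
move=> cV; apply: le_ereal_inf_tmp => _ [V Vx <-].
have [y Vy cy] := cV V Vx.
by apply: le_trans cy _; apply: ereal_sup_ubound; exists y.
Qed.

Lemma le_usc_env phi x : phi x <= usc_env phi x.
Proof.
by apply: usc_env_ge_frequently => V /nbhs_singleton Vx; exists x.
Qed.

Lemma usc_env_idem phi x : usc_env (usc_env phi) x <= usc_env phi x.
Proof.
apply: le_ereal_inf_tmp => _ [V Vx <-]; apply: usc_env_near_le.
by apply: filterS (nbhs_interior Vx) => y; exact: usc_env_le_sup.
Qed.

(** The slack [e] is there because domination controls increments only up to an error, on a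
    neighbourhood that depends on it. *)
Lemma usc_env_le_shift phi psi x (r : R) :
  (forall e : R, (0 < e)%R ->
    \forall y \near x, phi y <= psi y + (r + e)%:E) ->
  usc_env phi x <= usc_env psi x + r%:E.
Proof.
move=> H; apply/lee_addgt0Pr => e e0; rewrite -addeA -EFinD.
rewrite -leeBlDr//.
apply: le_ereal_inf_tmp => _ [V Vx <-].
rewrite leeBlDr//; apply: usc_env_near_le.
near=> y; apply: le_trans (_ : _ <= psi y + (r + e)%:E) _.
  by near: y; exact: H.
rewrite leeD2r//; apply: ereal_sup_ubound; exists y => //.
by near: y.
Unshelve. all: by end_near. Qed.

Lemma usc_env_le_near phi psi x :
  (\forall y \near x, phi y <= psi y) -> usc_env phi x <= usc_env psi x.
Proof.
move=> H; rewrite -[leRHS]adde0; apply: usc_env_le_shift => e e0.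
by apply: filterS H => y /le_trans; apply; rewrite add0r leeDl// lee_fin ltW.
Qed.

End Envelope.

(** * The real-valued modulus *)

Lemma cmodD {R : realType} (u v : cplx R) : cmod (u + v) <= cmod u + cmod v.
Proof. exact: le_normcD. Qed.

Lemma cmodN {R : realType} (u : cplx R) : cmod (- u) = cmod u.
Proof. exact: normcN. Qed.

Lemma cmod0 {R : realType} : cmod (0 : cplx R) = 0.
Proof. exact: Normc.normc0. Qed.

Lemma cmod_ge0 {R : realType} (u : cplx R) : 0 <= cmod u.
Proof. by case: u => a b; exact: sqrtr_ge0. Qed.

Lemma normr_cmod {R : realType} (u : cplx R) : `|u| = ((cmod u)%:C)%C.
Proof. by rewrite normc_def; case: u. Qed.

(** * Finite oscillations, their perturbation, and simple functions *)

Section OscillationTheory.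
Context {R : realType} {K : metricType R}.
Implicit Types (f g h : K -> cplx R) (F : K -> R) (x y : K).
Local Open Scope ereal_scope.

Lemma osc_ge0 f n x : 0 <= osc n f x.
Proof.
elim: n x => [//|n IHn] x /=.
apply: le_trans (le_usc_env _ _); apply: le_trans (le_usc_env _ _).
by rewrite adde_ge0// lee_fin cmod_ge0.
Qed.

Lemma osc_usc f n x : usc_env (osc n f) x <= osc n f x.
Proof.
case: n => [|n] /=; last exact: usc_env_idem.
by apply: usc_env_near_le; near=> y; rewrite /cst.
Unshelve. all: by end_near. Qed.

Lemma osc_le_tilde f n x : osc n f x <= osc_tilde_succ f (osc n f) x.
Proof.
by apply: le_trans (le_usc_env _ _); rewrite subrr cmod0 add0e.
Qed.

Lemma osc_leS f n x : osc n f x <= osc n.+1 f x.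
Proof. exact: le_trans (osc_le_tilde f n x) (le_usc_env _ _). Qed.

Lemma osc_mono f m n x : (m <= n)%N -> osc m f x <= osc n f x.
Proof.
move=> /subnK <-; elim: (n - m)%N => [//|k IHk].
by rewrite addSn; exact: le_trans IHk (osc_leS _ _ _).
Qed.

Lemma osc_le_omega f n x : osc n f x <= osc_omega f x.
Proof.
apply: le_trans (le_usc_env _ _).
by apply: ereal_sup_ubound; exists n.
Qed.

Lemma osc_cst0 n x : osc n (cst 0%R : K -> cplx R) x = 0.
Proof.
apply/eqP; rewrite eq_le osc_ge0 andbT.
elim: n x => [//|n IHn] x /=.
apply: usc_env_near_le; near=> y; apply: usc_env_near_le; near=> z.
by rewrite subrr cmod0 add0e.
Unshelve. all: by end_near. Qed.

(* For [h = sum_j phi_j] the function [F = sum_j |phi_j|] satisfies this, and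
   it bounds every [osc n h] by [sup F - F]: the increment of [F] pays for the
   jump of [h]. It also makes [F] lower semicontinuous. *)
Definition dominates F h : Prop := forall x (e : R), (0 < e)%R ->
  \forall y \near x, (cmod (h y - h x) + F x <= F y + e)%R.

(** From [y] to [z] the error term [M - F] drops by at least the jump of [h], up to [d], so jump and
    new error together cost no more than the old error. Only increments of [f], [g] and [h] are
    compared, so the roles of [f] and [g] can be exchanged with the same [h]. *)
Lemma osc_perturb f g h F (M : R) : dominates F h -> (forall x, F x <= M)%R ->
  (forall x y, cmod (f y - f x) <= cmod (g y - g x) + cmod (h y - h x))%R ->
  forall n x, osc n f x <= osc n g x + (M - F x)%:E.
Proof.
move=> Fh FM fgh; elim=> [|n IHn] x /=.
  by rewrite add0e lee_fin subr_ge0.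
apply: usc_env_le_shift => e e0; near=> y.
have lsc : (F x <= F y + e)%R.
  have : (cmod (h y - h x) + F x <= F y + e)%R by near: y; exact: (Fh).
  by apply: le_trans; rewrite lerDr cmod_ge0.
apply: (@le_trans _ _ (osc_tilde_succ g (osc n g) y + (M - F y)%:E)); last first.
  by rewrite leeD2l// lee_fin; lra.
apply: usc_env_le_shift => d d0; near=> z.
apply: le_trans (leeD2l _ (IHn z)) _.
rewrite [leLHS]addeCA [_ + osc n g z]addeC -addeA leeD2l//.
rewrite -!EFinD lee_fin.
have : (cmod (h z - h y) + F y <= F z + d)%R by near: z; exact: (Fh).
have := fgh y z.
lra.
Unshelve. all: by end_near. Qed.

Lemma osc_le_add f g h F (M : R) : dominates F h ->
  (forall x, 0 <= F x <= M)%R ->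
  (forall x y, cmod (f y - f x) <= cmod (g y - g x) + cmod (h y - h x))%R ->
  forall n x, osc n f x <= osc n g x + M%:E.
Proof.
move=> Fh FM fgh n x.
have FleM y : (F y <= M)%R by case/andP: (FM y).
apply: le_trans (osc_perturb Fh FleM fgh n x) _.
by rewrite leeD2l// lee_fin lerBlDr lerDl; case/andP: (FM x).
Qed.

Lemma osc_dominated_le f F (M : R) : dominates F f ->
  (forall x, 0 <= F x <= M)%R -> forall n x, osc n f x <= M%:E.
Proof.
move=> Ff FM n x; rewrite -[leRHS]add0e -(osc_cst0 n x).
by apply: osc_le_add Ff FM _ n x => y z; rewrite lerDr cmod_ge0.
Qed.

(* The complements of the [stable_at g i] are the closed sets obtained from [K]
   by repeatedly keeping the points where the restriction of [g] is not locally
   constant. *)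
Fixpoint stable_at g (i : nat) x : Prop :=
  if i is j.+1 then \forall y \near x, stable_at g j y \/ g y = g x else False.

Lemma stable_at_near g i x : stable_at g i x ->
  \forall y \near x, stable_at g i y.
Proof.
elim: i x => [//|i IHi] x /= Hx.
(* The condition at [x] holds near every [y] close to [x]; if [g y = g x], it is then the condition
   at [y]. *)
have HHx := nbhs_interior Hx.
near=> y.
have [yi|eyx] : stable_at g i y \/ g y = g x by near: y.
  by apply: filterS (IHi y yi) => z; left.
rewrite eyx; near: y; exact: HHx.
Unshelve. all: by end_near. Qed.

(** Near a point [y] of level [i.+1], a point [z] either has level [i], where by induction the last
    oscillation step added nothing, so its term is already counted in [osc m.+1 g y]; or
    [g z = g y], there is no jump, and upper semicontinuity of [osc m.+1 g] suffices. *)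
Lemma osc_stable g i n x : stable_at g i x -> (i <= n)%N ->
  osc n.+1 g x <= osc n g x.
Proof.
elim: i n x => [//|i IHi] [//|m] x gx; rewrite ltnS => im.
apply: le_trans (osc_usc g m.+1 x).
apply: usc_env_le_near; near=> y.
have gy : stable_at g i.+1 y by near: y; exact: stable_at_near.
apply/lee_addgt0Pr => e e0.
have [->|oscoo] := eqVneq (osc m.+1 g y) +oo; first by rewrite addye// leey.
have lte : osc m.+1 g y < osc m.+1 g y + e%:E.
  by rewrite lteDl// ge0_fin_numE ?osc_ge0// ltey.
apply: usc_env_near_le; near=> z.
have oz : osc m.+1 g z < osc m.+1 g y + e%:E.
  near: z; apply: usc_env_lt_near; exact: le_lt_trans (osc_usc _ _ _) lte.
have [zi|->] : stable_at g i z \/ g z = g y by near: z.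
- apply: le_trans (leeD2l _ (IHi m z zi im)) _; apply: ltW.
  near: z; apply: usc_env_lt_near; apply: le_lt_trans lte.
  exact: le_usc_env.
- by rewrite subrr cmod0 add0e ltW.
Unshelve. all: by end_near. Qed.

(** Arbitrarily close to a point unstable at level [i.+1] lies a [y] unstable at level [i] with
    another value of [g]: its jump adds [d] to the bound [d *+ i] at [y]. *)
Lemma osc_unstable g (d : R) :
  (forall x y, g y <> g x -> d <= cmod (g y - g x))%R ->
  forall i x, ~ stable_at g i x -> (d *+ i)%:E <= osc i g x.
Proof.
move=> gd; elim=> [|i IHi] x; first by rewrite mulr0n.
move=> gx; apply: le_trans (le_usc_env _ _).
apply: usc_env_ge_frequently => V Vx; apply: contrapT => nV; apply: gx.
apply: filterS Vx => y Vy; apply: contrapT => /not_orP[yi gyx]; apply: nV.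
exists y => //; rewrite mulrS EFinD; apply: leeD; last exact: IHi.
by rewrite lee_fin gd.
Qed.

Lemma simple_gap g : simple g -> exists2 d : R, (0 < d)%R &
  forall x y, g y <> g x -> (d <= cmod (g y - g x))%R.
Proof.
move=> /finite_seqP[s gs].
have [d d0 dP] : exists2 d : R, (0 < d)%R &
    forall r, r \in [seq cmod (u - v)%R | u <- s, v <- s] -> (0 < r -> d <= r)%R.
  (* Minimum of the positive distances between values, with default 1 when there is none, as for a
     constant [g]. *)
  elim: [seq _ | _ <- _, _ <- _] => [|r t [d d0 dt]]; first by exists 1%R.
  have [r0|r0] := ltP 0%R r.
    exists (Num.min d r); first by rewrite lt_min d0.
    move=> q; rewrite inE => /predU1P[->|qt] q0; rewrite ge_min ?lexx ?orbT//.
    by rewrite dt.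
  exists d => // q; rewrite inE => /predU1P[->|qt q0]; last exact: dt.
  by rewrite ltNge r0.
exists d => // x y gxy; apply: dP.
  have gin z : g z \in s by have : range g (g z) by []; rewrite gs.
  by apply/allpairsP; exists (g y, g x); split => //=; exact: gin.
rewrite lt_neqAle cmod_ge0 andbT eq_sym; apply/eqP => /Normc.eq0_normc/eqP.
by rewrite subr_eq0 => /eqP.
Qed.

Lemma osc_simple_stationary g (M : R) : simple g ->
  (forall n x, osc n g x <= M%:E) ->
  exists N, forall n x, (N <= n)%N -> osc n g x = osc N g x.
Proof.
move=> /simple_gap[d d0 gd] gM.
have [N NP] : exists N, forall x, stable_at g N x.
  (* A point unstable at level [k] would give [d *+ k <= osc k g x <= M]. *)
  have [k kP] : exists k : nat, (M / d < k%:R)%R.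
    by exists (Num.truncn (M / d)).+1; rewrite truncnS_gt.
  exists k => x; apply: contrapT => /(osc_unstable gd).
  move=> /le_trans/(_ (gM k x)); rewrite lee_fin leNgt -mulr_natl.
  by rewrite -ltr_pdivrMr// kP.
exists N => n x Nn; apply/eqP; rewrite eq_le (osc_mono _ _ Nn) andbT.
rewrite -(subnK Nn); elim: (n - N)%N => [//|k IHk].
rewrite addSn; apply: le_trans (osc_stable (NP x) _) IHk.
exact: leq_addl.
Qed.

(** The bound survives the supremum over [m], and the outer envelope costs nothing because [osc n f]
    is already upper semicontinuous. *)
Lemma osc_omega_le f n (M : R) :
  (forall m x, osc m f x <= osc n f x + M%:E) ->
  forall x, osc_omega f x <= osc n f x + M%:E.
Proof.
move=> H x; apply: le_trans (leeD2r _ (osc_usc f n x)).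
apply: usc_env_le_shift => e e0; near=> y.
apply: (@le_trans _ _ (osc n f y + M%:E)).
  by apply: ge_ereal_sup => _ [m _ <-].
by rewrite leeD2l// lee_fin lerDl ltW.
Unshelve. all: by end_near. Qed.

End OscillationTheory.

(** * Dominating functions for elements of D(K) *)

Section Domination.
Context {R : realType} {K : metricType R}.
Implicit Types (f g h : K -> cplx R) (F : K -> R) (x y : K).

Lemma cvg_cmod {T : Type} (G : set_system T) {FG : Filter G} (u : T -> cplx R)
    (l : cplx R) : u @ G --> l ->
  forall e : R, 0 < e -> \forall t \near G, cmod (u t - l) < e.
Proof.
move=> /cvgrPdist_lt ul e e0.
have ec0 : 0 < ((e%:C)%C : R[i]) by rewrite ltcR.
apply: filterS (ul _ ec0) => t.
by rewrite distrC normr_cmod ltcR.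
Qed.

Lemma lsc_near (phi : K -> R) x (e : R) : lower_semicontinuous (EFin \o phi) ->
  0 < e -> \forall y \near x, phi x <= phi y + e.
Proof.
move=> phil e0; have [|V Vx Vphi] := phil x (phi x - e).
  by rewrite lte_fin gtrBl.
apply: filterS Vx => y /Vphi; rewrite lte_fin => /ltW.
by rewrite lerBlDr.
Qed.

Lemma bounded_lsc_bound (phi : K -> R) : bounded_lsc phi ->
  exists M : R, forall x, `|phi x| <= M.
Proof.
(* [ex_bound] does not apply: [K] may be empty. *)
move=> [phib _]; near (pinfty_nbhs R) => M; exists M => x.
have phiM : globally [set: K] [set y | `|(phi y : R^o)| <= M] by near: M.
exact: phiM.
Unshelve. all: by end_near. Qed.

Lemma cmod_Complex_le (a b : R) : cmod (Complex a b) <= `|a| + `|b|.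
Proof.
have -> : Complex a b = Complex a 0 + Complex 0 b.
  by apply/eqP; rewrite eq_complex /= addr0 add0r !eqxx.
apply: le_trans (cmodD _ _) _.
by rewrite /cmod /= expr0n /= addr0 add0r !sqrtr_sqr.
Qed.

(** The sum of the four lower semicontinuous functions dominates: none of them drops by more than a
    small error near [x], so the sum of their increments controls every difference. Adding [S] makes
    the sum nonnegative. *)
Lemma classD_dominates g : classD g ->
  exists (F : K -> R) (M : R), dominates F g /\ forall x, 0 <= F x <= M.
Proof.
move=> [p1 [p2 [p3 [p4 [b1 b2 b3 b4 gE]]]]].
have [[M1 H1] [M2 H2]] := (bounded_lsc_bound b1, bounded_lsc_bound b2).
have [[M3 H3] [M4 H4]] := (bounded_lsc_bound b3, bounded_lsc_bound b4).
move: b1 b2 b3 b4 => [_ l1] [_ l2] [_ l3] [_ l4].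
pose S := M1 + M2 + M3 + M4.
exists (fun x => p1 x + p2 x + p3 x + p4 x + S), (S + S); split; last first.
  move=> x; move: (H1 x) (H2 x) (H3 x) (H4 x); rewrite !ler_norml /S.
  by move=> /andP[? ?] /andP[? ?] /andP[? ?] /andP[? ?]; apply/andP; split; lra.
move=> x e e0; have d0 : 0 < e / 8 by lra.
near=> y.
have : p1 x <= p1 y + e / 8 by near: y; exact: lsc_near.
have : p2 x <= p2 y + e / 8 by near: y; exact: lsc_near.
have : p3 x <= p3 y + e / 8 by near: y; exact: lsc_near.
have : p4 x <= p4 y + e / 8 by near: y; exact: lsc_near.
move=> q4 q3 q2 q1.
have -> : g y - g x = Complex ((p1 y - p2 y) - (p1 x - p2 x))
                              ((p3 y - p4 y) - (p3 x - p4 x)).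
  by rewrite !gE.
have := cmod_Complex_le ((p1 y - p2 y) - (p1 x - p2 x))
                        ((p3 y - p4 y) - (p3 x - p4 x)).
(* If [a] and [b] are at least [- c], then [|a - b| <= a + b + 2 c]; here [c] is [e / 8]. *)
have : `|(p1 y - p2 y) - (p1 x - p2 x)| <=
    p1 y - p1 x + (p2 y - p2 x) + e / 2.
  by rewrite ler_norml; apply/andP; split; lra.
have : `|(p3 y - p4 y) - (p3 x - p4 x)| <=
    p3 y - p3 x + (p4 y - p4 x) + e / 2.
  by rewrite ler_norml; apply/andP; split; lra.
lra.
Unshelve. all: by end_near. Qed.

Lemma cmod_sum_le (I : Type) (r : seq I) (u : I -> cplx R) :
  cmod (\sum_(i <- r) u i) <= \sum_(i <- r) cmod (u i).
Proof.
apply: (big_ind2 (fun u r => cmod u <= r)) => // [|u1 r1 u2 r2 H1 H2].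
  by rewrite cmod0.
by apply: le_trans (cmodD _ _) _; exact: lerD.
Qed.

(* The dominating function is [sum_j |phi_j|]. *)
Lemma D_repr_dominates h (phi : nat -> K -> cplx R) (M : R) :
  D_repr h phi -> (sup_abs_sum phi <= M%:E)%E ->
  exists F : K -> R, dominates F h /\ forall x, 0 <= F x <= M.
Proof.
move=> [cphi _ hphi] supM.
pose T N x := \sum_(0 <= j < N) cmod (phi j x).
pose FE x := (\sum_(0 <= j <oo) (cmod (phi j x))%:E)%E.
have FE0 x : (0 <= FE x)%E.
  by apply: nneseries_ge0 => j _ _; rewrite lee_fin cmod_ge0.
have FEM x : (FE x <= M%:E)%E.
  by apply: le_trans supM; apply: ereal_sup_ubound; exists x.
have FEfin x : (fine (FE x))%:E = FE x.
  by rewrite fineK// ge0_fin_numE// (le_lt_trans (FEM x))// ltry.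
pose F x := fine (FE x).
have TF N x : T N x <= F x.
  rewrite -lee_fin FEfin -sumEFin; apply: nneseries_lim_ge => j _ _.
  by rewrite lee_fin cmod_ge0.
have FT x (e : R) : 0 < e -> exists N, F x <= T N x + e.
  move=> e0; apply: contrapT => /forallNP nN.
  have : (FE x <= (F x - e)%:E)%E.
    apply: lime_le.
      by apply: is_cvg_nneseries => j _ _; rewrite lee_fin cmod_ge0.
    near=> N; rewrite sumEFin lee_fin lerBrDr.
    by apply: ltW; have /negP := nN N; rewrite -ltNge.
  by rewrite -FEfin lee_fin; apply/negP; rewrite -ltNge gtrBl.
pose S N x := series (fun j => phi j x) N.
have SN x N m : (N <= m)%N -> cmod (S m x - S N x) <= T m x - T N x.
  move=> Nm; rewrite /S /T sub_series_geq//.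
  rewrite [in leRHS](big_cat_nat (leq0n N) Nm)/= [leRHS]addrAC subrr add0r.
  exact: cmod_sum_le.
(* Tail estimate: let [m] tend to infinity in [SN]. *)
have hS N x : cmod (h x - S N x) <= F x - T N x.
  apply/ler_addgt0Pr => e e0.
  near \oo => m.
  have Nm : (N <= m)%N by near: m; exists N.
  have : cmod (S m x - h x) < e by near: m; exact: (cvg_cmod (hphi x)).
  have := SN x N m Nm; have := TF m x.
  rewrite -(cmodN (S m x - h x)) opprB.
  have := cmodD (h x - S m x) (S m x - S N x).
  by rewrite addrA subrK; lra.
exists F; split; last first.
  by move=> x; rewrite -!lee_fin FEfin FE0 FEM.
move=> x e e0; have d0 : 0 < e / 4 by lra.
have [N FN] := FT x _ d0.
have near_sum : \forall y \near x,
    \sum_(0 <= j < N) cmod (phi j y - phi j x) <= e / 4.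
  (* The bound is generalised so that each new term can take half of it. *)
  elim: N {FN} (e / 4) d0 => [|N IHN] d d0.
    by near=> y; rewrite big_nil// ltW.
  have d20 : 0 < d / 2 by lra.
  near=> y; rewrite big_nat_recr//=.
  have : \sum_(0 <= j < N) cmod (phi j y - phi j x) <= d / 2.
    by near: y; exact: (IHN _ d20).
  have : cmod (phi N y - phi N x) < d / 2.
    by near: y; exact: (cvg_cmod (cphi N x)).
  lra.
near=> y.
have dN : \sum_(0 <= j < N) cmod (phi j y - phi j x) <= e / 4 by near: y.
have Sxy : cmod (S N y - S N x) <= e / 4.
  by rewrite /S /series/= -sumrB; apply: le_trans dN; exact: cmod_sum_le.
have Txy : T N x <= T N y + e / 4.
  apply: le_trans (lerD (lexx _) dN); rewrite /T -big_split/=.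
  apply: ler_sum => j _; rewrite -[cmod (_ - _)]cmodN opprB.
  by rewrite -{1}(subrKC (phi j y) (phi j x)) cmodD.
(* Budget: one [e / 4] for the jump of [S N], one for that of [T N], and two because
   [F x <= T N x + e / 4] is used twice, in the tail at [x] and for the summand [F x]. *)
have := hS N x; have := hS N y.
have := cmodD (h y - S N y) ((S N y - S N x) + (S N x - h x)).
have := cmodD (S N y - S N x) (S N x - h x).
have -> : (h y - S N y) + ((S N y - S N x) + (S N x - h x)) = h y - h x.
  by rewrite !addrA !subrK.
rewrite -[cmod (S N x - h x)]cmodN opprB.
lra.
Unshelve. all: by end_near. Qed.

End Domination.

Theorem proposition4p4 (R : realType) (K : metricType R) (f : K -> cplx R)
    (hf : classSD f) :
  ereal_uniform_cvg (fun n => osc n f) (osc_omega f).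
Proof.
move=> e e0; have d0 : 0 < e / 3 by lra.
have [_ /(_ _ d0)[g [gD gsimple /ereal_inf_lt[_ [phi fgphi <-] phid]]]] := hf.
have [F [Fdom FM]] := D_repr_dominates fgphi (ltW phid).
have [G [M [Gdom GM]]] := classD_dominates gD.
have oscgM := osc_dominated_le Gdom GM.
have [N Nstat] := osc_simple_stationary gsimple oscgM.
have split y z : f z - f y = (g z - g y) + ((f \- g) z - (f \- g) y).
  by rewrite /= opprB addrACA subrKC addKr.
have fg n x : (osc n f x <= osc n g x + (e / 3)%:E)%E.
  by apply: (osc_le_add Fdom FM) => y z; rewrite split cmodD.
have gf n x : (osc n g x <= osc n f x + (e / 3)%:E)%E.
  apply: (osc_le_add Fdom FM) => y z.
  have -> : g z - g y = (f z - f y) - ((f \- g) z - (f \- g) y).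
    by rewrite split addrK.
  by apply: le_trans (cmodD _ _) _; rewrite cmodN.
exists N => // n /= Nn x.
(* For [m > n], pass from [f] to [g] at rank [m], move to rank [n] where [g] has the same
   oscillation, and return to [f]: two errors of [e / 3], leaving room for the strict bound. *)
have osc_late m y : (osc m f y <= osc n f y + (e / 3 + e / 3)%:E)%E.
  have [mn|/ltnW nm] := leqP m n.
    by apply: le_trans (osc_mono _ _ mn) _; rewrite leeDl// lee_fin; lra.
  apply: le_trans (fg m y) _; rewrite EFinD addeA leeD2r//.
  by rewrite Nstat ?(leq_trans Nn)// -(Nstat n)//.
have := osc_omega_le osc_late x.
have := osc_le_omega f n x.
(* Finiteness of [osc n f x], inherited from [g], also forces that of [osc_omega f x] and reduces
   the claim to real numbers. *)
have oscf_fin : osc n f x \is a fin_num.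
  rewrite ge0_fin_numE ?osc_ge0//; apply: le_lt_trans (fg n x) _.
  by apply: le_lt_trans (leeD2r _ (oscgM n x)) _; rewrite -EFinD ltry.
move: (osc_omega f x) (osc n f x) oscf_fin => [w| |] [u| |]//= _.
rewrite !lee_fin => uw wu; rewrite lte_fin ltr_norml.
by apply/andP; split; lra.
Qed.
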